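(* For all integers $\ell\ge1$, $n\ge0$ and $\alpha>1$: \[ \overline{p}_{3\ell}(48n+6j+1)\equiv0 \pmod{4}\quad\text{for } j\in\{1,2,3,5,6,7\}, \] \[ \overline{p}_{3\ell}(3n+1)\equiv\overline{p}_{3\ell}\bigl(4^\alpha(3n+1)\bigr)\pmod{4}, \] \[ \overline{p}_{3\ell}\bigl(4^{\alpha+1}(6n+5)\bigr)\equiv0\pmod{4}, \] \[ \overline{p}_{3\ell}\bigl(4^\alpha(6n+5)\bigr)\equiv0\pmod{8}, \] \[ \overline{p}_{3\ell}(3n+2)\equiv\overline{p}_{3\ell}\bigl(4^{\alpha}(3n+2)\bigr)\pmod{8}. \]
   Context: For $k\ge1$ let $f_k=\prod_{m\ge1}(1-q^{km})$. For an integer $\ell\ge1$, $\overline{p}_\ell(n)$ denotes the number of 2-color overpartitions of $n$ (the first occurrence of a part of each color may be overlined) in which one of the two colors appears only in parts that are multiples of $\ell$; its generating function is $\sum_{n\ge0}\overline{p}_\ell(n)q^n=\dfrac{f_2f_{2\ell}}{f_1^2f_\ell^2}$. *)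

(* Defs.v *)
From mathcomp Require Import all_boot.

Set Implicit Arguments.
Unset Strict Implicit.
Unset Printing Implicit Defensive.

(* A pair (c, i) stands for the part i.+1 in colour c; a partition of n has no
   part larger than n.  The restricted colour is [true]. *)
Definition colored_part (n : nat) : finType := (bool * 'I_n)%type.

Definition part_size (n : nat) (x : colored_part n) : nat := x.2.+1.

(* A 2-colour overpartition, as the multiplicities of its coloured parts and the
   set of coloured parts whose first occurrence is overlined.  A part of a
   partition of n occurs at most n times. *)
Definition overpartition_data (n : nat) : finType :=
  ({ffun colored_part n -> 'I_n.+1} * {set colored_part n})%type.

Definition is_overpartition (l n : nat) (p : overpartition_data n) : bool :=
  [&& \sum_(x : colored_part n) p.1 x * part_size x == n,
      [forall x in p.2, 0 < p.1 x]
    & [forall x : colored_part n,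
         (x.1 && (0 < p.1 x)) ==> (l %| part_size x)]].

Definition overp (l n : nat) : nat :=
  #|[set p : overpartition_data n | is_overpartition l p]|.

(* Main.v *)
(* An underlying partition with k distinct coloured parts carries 2^k overlinings,
   so modulo 8 only partitions with one or two distinct coloured parts count, with
   weights 2 and 4.  For N prime to 3 the former are the rectangles N = i m, hence
   overp(N) = 2 d(N) mod 4.  For N = 2 mod 3 the latter are counted modulo 2 by
   conjugation: with one part of each colour, N = i m + 3 l j k, swapping i and m
   has no fixed point because 2 is not a square mod 3; with two unrestricted parts
   the self-conjugate partitions are N = m (m + 2 k), i.e. the factorisations
   N = a b with a < b of the same parity.  Since N is not a square, 2 d(N) plus
   4 times their number is 4 times the number of factorisations of N into an odd
   and an even factor, which for even N is 4 d(odd part of N). *)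

Require Import Defs.
From mathcomp Require Import all_boot zify.

Set Implicit Arguments.
Unset Strict Implicit.
Unset Printing Implicit Defensive.

(** * Involutions and the parity of divisor counts *)

Lemma odd_card_involution (T : finType) (A : {set T}) (f : T -> T) :
  {in A, forall x, f x \in A} -> {in A, involutive f} ->
  odd #|A| = odd #|[set x in A | f x == x]|.
Proof.
(* The enumeration of [T] splits the points moved by [f] into those ranked before and those ranked
   after their image; [f] exchanges the two halves. *)
move=> fA fK; pose B c := [set x in A | c (enum_rank x : nat) (enum_rank (f x) : nat)].
have cardB: #|B ltn| = #|B (fun a b => b < a)|.
  have finj : {in B ltn &, injective f}.
    move=> x y; rewrite !inE => /andP[Ax _] /andP[Ay _] e.
    by rewrite -(fK x) // e fK.
  rewrite -(card_in_imset finj); apply: eq_card => y.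
  rewrite !inE; apply/imsetP/andP => [[x] | [Ay lty]].
    by rewrite inE => /andP[Ax ltx] ->; rewrite fA // fK.
  by exists (f y); rewrite ?inE ?fA ?fK.
have -> : #|A| = #|B ltn| + #|B (fun a b => b < a)| + #|[set x in A | f x == x]|.
  rewrite -!sum1dep_card -sum1_card 2!big_mkcondr [X in _ + X]big_mkcondr.
  rewrite -!big_split /=; apply: eq_bigr => x Ax.
  by rewrite -(inj_eq enum_rank_inj) -val_eqE; case: ltngtP.
by rewrite -cardB addnn oddD odd_double.
Qed.

Lemma codivisorK (n a : nat) : 0 < n -> a %| n -> n %/ (n %/ a) = a.
Proof. by move=> n_gt0 a_n; rewrite divnA // mulKn. Qed.

Lemma perm_codivisors (n : nat) : 0 < n ->
  perm_eq [seq n %/ a | a <- divisors n] (divisors n).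
Proof.
move=> n_gt0.
have cod_inj : {in divisors n &, injective (divn n)}.
  move=> a b; rewrite -!dvdn_divisors // => a_n b_n e.
  by rewrite -(codivisorK n_gt0 a_n) e codivisorK.
apply: uniq_perm; rewrite ?(map_inj_in_uniq cod_inj) ?divisors_uniq //.
move=> b; apply/mapP/idP => [[a] | ]; rewrite -dvdn_divisors //.
  by move=> a_n ->; rewrite -dvdn_divisors // dvdn_div.
by move=> b_n; exists (n %/ b); rewrite -?dvdn_divisors ?dvdn_div ?codivisorK.
Qed.

Lemma count_codivisors (n : nat) (P : pred nat) : 0 < n ->
  count P (divisors n) = count (fun a => P (n %/ a)) (divisors n).
Proof.
by move=> n_gt0; rewrite -(permP (perm_codivisors n_gt0)) count_map.
Qed.

(** The involution [a -> n %/ a] exchanges the divisors below and above the square root of [n]. *)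
Lemma size_divisors_split (n : nat) : 0 < n ->
  size (divisors n) = (count (fun a => a < n %/ a) (divisors n)).*2
                      + count (fun a => n %/ a == a) (divisors n).
Proof.
move=> n_gt0; rewrite -addnn.
have {2}-> : count (fun a => a < n %/ a) (divisors n)
           = count (fun a => n %/ a < a) (divisors n).
  rewrite count_codivisors //; apply: eq_in_count => a.
  by rewrite -dvdn_divisors // => a_n; rewrite codivisorK.
elim: (divisors n) => //= a s ->.
by case: (ltngtP a (n %/ a)) => _ /=; lia.
Qed.

Lemma odd_size_divisorsP (n : nat) : 0 < n ->
  reflect (exists x, x ^ 2 = n) (odd (size (divisors n))).
Proof.
move=> n_gt0; rewrite size_divisors_split // oddD odd_double /=.
apply: (iffP idP) => [odd_c | [x def_n]].
  have : 0 < count (fun a => n %/ a == a) (divisors n) by case: count odd_c.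
  rewrite -has_count => /hasP[a]; rewrite -dvdn_divisors // => /divnK def_n /eqP a_a.
  by exists a; rewrite -mulnn -{2}a_a mulnC.
have x_gt0 : 0 < x by case: x def_n n_gt0 => // <-.
have x_n : x \in divisors n by rewrite -dvdn_divisors // -def_n dvdn_exp.
rewrite (@eq_in_count _ _ (pred1 x)) ?count_uniq_mem ?divisors_uniq ?x_n //.
move=> a /=; rewrite -dvdn_divisors // => /divnK e; apply/eqP/eqP; move: e def_n; nia.
Qed.

(** An odd divisor is coprime to the 2-part of [n], so by Gauss it divides the odd part. *)
Lemma count_odd_divisors (n : nat) : 0 < n ->
  count odd (divisors n) = size (divisors n`_2^').
Proof.
move=> n_gt0; rewrite -size_filter; apply/perm_size/uniq_perm.
- by rewrite filter_uniq ?divisors_uniq.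
- exact: divisors_uniq.
move=> a; rewrite mem_filter -!dvdn_divisors ?part_gt0 //.
rewrite -{1}(partnC 2 n_gt0); apply/andP/idP => [[odd_a] | a_n].
  rewrite Gauss_dvdr //; have a_gt0 : 0 < a by case: a odd_a.
  by rewrite p_part coprimeXr // coprimen2.
split; last exact: dvdn_mull.
by apply: dvdn_odd a_n _; have := part_pnat 2^' n; rewrite p'natE // dvdn2 negbK.
Qed.

(* For n not a square, pairing a with n / a gives 2 d(n) = 4 #{a | a < n / a}, so
   the divisors a for which a and n / a have the same parity cancel mod 8. *)
Lemma divisors_parity_mod8 (n : nat) : 0 < n -> ~~ odd (size (divisors n)) ->
  2 * size (divisors n)
    + 4 * count (fun a => (a < n %/ a) && (odd a == odd (n %/ a))) (divisors n)
  = 4 * (~~ odd n * size (divisors n`_2^')) %[mod 8].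
Proof.
move=> n_gt0 even_d.
have no_fix a : a \in divisors n -> n %/ a != a.
  move=> a_n; apply: contraNneq even_d => a_a; apply/odd_size_divisorsP => //.
  by exists a; move: a_n; rewrite -dvdn_divisors // => /divnK <-; rewrite a_a.
have -> : ~~ odd n * size (divisors n`_2^')
        = count (fun a => odd a && ~~ odd (n %/ a)) (divisors n).
  have odd_n a : a \in divisors n -> odd n = odd a && odd (n %/ a).
    by rewrite -dvdn_divisors // => /divnK {1}<-; rewrite oddM andbC.
  rewrite -count_odd_divisors //; case: (boolP (odd n)) => odd_n0 /=.
    rewrite mul0n (@eq_in_count _ _ pred0) ?count_pred0 // => a /odd_n.
    by rewrite odd_n0 => /esym/andP[-> ->].
  rewrite mul1n; apply: eq_in_count => a /odd_n; rewrite (negPf odd_n0).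
  by do 2!case: odd.
(* A factorisation of [n] into an odd and an even factor is recorded by its odd factor on the left
   and by its smaller factor on the right. *)
have -> : count (fun a => odd a && ~~ odd (n %/ a)) (divisors n)
        = count (fun a => (a < n %/ a) && (odd a != odd (n %/ a))) (divisors n).
  pose P b c := [&& b < c, ~~ odd b & odd c].
  have swapP : count (fun a => P (n %/ a) a) (divisors n)
             = count (fun a => P a (n %/ a)) (divisors n).
    rewrite count_codivisors //; apply: eq_in_count => a.
    by rewrite -dvdn_divisors // => a_n; rewrite codivisorK.
  transitivity (count (fun a => [&& a < n %/ a, odd a & ~~ odd (n %/ a)]) (divisors n)
     + count (fun a => P (n %/ a) a) (divisors n)); last rewrite swapP;
  elim: (divisors n) no_fix => //= a s IHs no_fix;
  have {}IHs := IHs (fun b s_b => no_fix b (mem_behead (s := a :: s) s_b));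
  move: (no_fix a (mem_head _ _)); rewrite /P in IHs *;
  by case: ltngtP => //= _ _; do 2!case: odd => //=; lia.
have fix0 : count (fun a => n %/ a == a) (divisors n) = 0.
  by apply/eqP; rewrite -leqn0 leqNgt -has_count; apply/hasPn.
rewrite size_divisors_split // fix0.
have -> : count (fun a => a < n %/ a) (divisors n)
  = count (fun a => (a < n %/ a) && (odd a == odd (n %/ a))) (divisors n)
  + count (fun a => (a < n %/ a) && (odd a != odd (n %/ a))) (divisors n).
  by elim: (divisors n) => //= a s ->; case: (a < _) => //=; case: eqP => /=; lia.
lia.
Qed.

(** * Overpartitions modulo 8 by number of distinct coloured parts *)

Definition supp (n : nat) (f : {ffun colored_part n -> 'I_n.+1}) :
    {set colored_part n} :=
  [set x | 0 < f x].

Definition is_partition (l n : nat) (f : {ffun colored_part n -> 'I_n.+1}) : bool :=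
  (\sum_x f x * part_size x == n)
  && [forall x : colored_part n, (x.1 && (0 < f x)) ==> (l %| part_size x)].

Definition partitions_supp (l n k : nat) : {set {ffun colored_part n -> 'I_n.+1}} :=
  [set f | is_partition l f & #|supp f| == k].

(** The admissible sets of overlined parts for multiplicities [f] are exactly the subsets of
    [supp f]. *)
Lemma overpE (l n : nat) :
  overp l n =
    \sum_(f : {ffun colored_part n -> 'I_n.+1} | is_partition l f) 2 ^ #|supp f|.
Proof.
rewrite /overp cardsE -sum1_card.
rewrite (eq_bigl (fun p => is_partition l p.1 && (p.2 \in powerset (supp p.1)))).
  rewrite -(pair_big_dep (is_partition l (n := n))
    (fun f s => s \in powerset (supp f)) (fun _ _ => 1)) /=.
  by apply: eq_bigr => f _; rewrite sum1_card card_powerset.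
case=> f s; rewrite powersetE [LHS]unfold_in /is_partition /= -andbA.
congr (_ && _); rewrite andbC; congr (_ && _).
apply/forallP/subsetP => [s_f x s_x | s_f x].
  by rewrite inE; apply: (implyP (s_f x)).
by apply/implyP => /s_f; rewrite inE.
Qed.

Lemma card_supp_gt0 (l n : nat) (f : {ffun colored_part n -> 'I_n.+1}) :
  0 < n -> is_partition l f -> 0 < #|supp f|.
Proof.
move=> n_gt0 /andP[/eqP sum_f _]; rewrite card_gt0; apply: contraTneq n_gt0 => f0.
rewrite -sum_f big1 // => x _; have : x \notin supp f by rewrite f0 inE.
by rewrite inE -eqn0Ngt => /eqP->.
Qed.

Lemma overp_mod8 (l n : nat) : 0 < n ->
  overp l n = 2 * #|partitions_supp l n 1| + 4 * #|partitions_supp l n 2| %[mod 8].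
Proof.
move=> n_gt0.
have cardE k : #|partitions_supp l n k|
    = \sum_(f | is_partition l f) (#|@supp n f| == k : nat).
  by rewrite -sum1dep_card big_mkcondr; apply: eq_bigr => f _; case: eqP.
rewrite overpE !cardE !big_distrr -big_split /= -modn_summ -[RHS]modn_summ.
congr (_ %% 8); apply: eq_bigr => f /(card_supp_gt0 n_gt0).
case: #|_| => [|[|[|k]]] //= _.
by rewrite !expnS; lia.
Qed.

Lemma overp_mod4 (l n : nat) : 0 < n ->
  overp l n = 2 * #|partitions_supp l n 1| %[mod 4].
Proof.
move=> n_gt0; rewrite -(@modn_dvdm 8 (overp l n)) // overp_mod8 //; lia.
Qed.

(** * Partitions with one or two distinct coloured parts *)

Definition single (n : nat) (x : colored_part n) (m : nat) :
    {ffun colored_part n -> 'I_n.+1} :=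
  [ffun z => if z == x then inord m else ord0].

(** A single restricted part would make [l] divide [n]; hence the part is unrestricted, its size is
    a divisor [a], and its multiplicity is [n %/ a]. *)
Lemma card_partitions_supp1 (l n : nat) : 0 < n -> ~~ (l %| n) ->
  #|partitions_supp l n 1| = size (divisors n).
Proof.
case: n => // n _ l_n.
(* Index [a.-1] stands for the part [a]; both [inord] are exact because [0 < a <= n.+1]. *)
pose F a := single (false, inord a.-1 : 'I_n.+1) (n.+1 %/ a).
have sizeF a : a %| n.+1 -> part_size (false, inord a.-1 : 'I_n.+1) = a.
  move=> a_n; have := dvdn_leq (ltn0Sn n) a_n; have := dvdn_gt0 (ltn0Sn n) a_n.
  by rewrite /part_size /= => *; rewrite inordK; lia.
have suppF a : a %| n.+1 -> supp (F a) = [set (false, inord a.-1)].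
  move=> a_n; apply/setP=> z; rewrite !inE ffunE; case: eqP => // _.
  rewrite inordK ?ltnS ?leq_div //.
  by rewrite divn_gt0 ?(dvdn_gt0 _ a_n) // dvdn_leq.
rewrite -(size_map F) cardE; apply/perm_size/uniq_perm; first exact: enum_uniq.
  rewrite map_inj_in_uniq ?divisors_uniq // => a b.
  rewrite -!dvdn_divisors // => a_n b_n eF.
  rewrite -(sizeF a) // -(sizeF b) //; congr part_size; apply/set1P.
  by rewrite -suppF // -eF suppF // set11.
move=> f; rewrite mem_enum inE; apply/andP/mapP => [[]|[a]].
  case/andP=> /eqP sum_f /forallP col_f /cards1P[x supp_f].
  have f0 z : z != x -> f z = ord0.
    move=> zx; apply/val_inj/eqP; rewrite -leqn0 leqNgt.
    have : z \notin supp f by rewrite supp_f in_set1.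
    by rewrite inE.
  have fx : 0 < f x by move: (set11 x); rewrite -supp_f inE.
  rewrite (bigD1 x) //= big1 ?addn0 in sum_f; last by move=> z /f0->.
  have x_n : part_size x %| n.+1 by apply/dvdnP; exists (f x).
  exists (part_size x); first by rewrite -dvdn_divisors.
  case: x x_n f0 fx sum_f {supp_f} => [[] i] x_n f0 fx sum_f.
    by move: (col_f (true, i)); rewrite fx /= => /dvdn_trans/(_ x_n); rewrite (negPf l_n).
  have -> : F (part_size (false, i)) = single (false, i) (n.+1 %/ part_size (false, i)).
    by rewrite /F; congr (single (_, _) _); apply/val_inj; rewrite /= inordK.
  apply/ffunP=> z; rewrite ffunE; case: eqVneq => [-> | /f0 //].
  by rewrite -[X in X %/ _]sum_f mulnK // inord_val.
rewrite -dvdn_divisors // => a_n ->; split; last by rewrite suppF ?cards1.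
apply/andP; split; last first.
  apply/forallP=> z; apply/implyP=> /andP[z1]; rewrite ffunE.
  by case: eqP z1 => [-> |].
rewrite (bigD1 (false, inord a.-1)) //= big1 ?addn0 => [|z /negPf z_a].
  by rewrite ffunE eqxx sizeF // inordK ?divnK // ltnS leq_div.
by rewrite ffunE z_a.
Qed.

(** Unrestricted parts come before restricted ones, and larger before smaller within a colour; this
    orders each two-element support in one way. *)
Definition precedes (n : nat) (x y : colored_part n) : bool :=
  if x.1 == y.1 then y.2 < x.2 else y.1.

Lemma precedes_neq (n : nat) (x y : colored_part n) : precedes x y -> x != y.
Proof. by apply: contraTneq => ->; rewrite /precedes eqxx ltnn. Qed.

Lemma precedes_antisym (n : nat) (x y : colored_part n) :
  x != y -> precedes y x = ~~ precedes x y.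
Proof.
case: x y => [[] i] [[] j] //=; rewrite /precedes xpair_eqE /= -?val_eqE /=; by case: ltngtP.
Qed.

Definition two_part_data (n : nat) : finType :=
  (colored_part n * 'I_n.+1 * (colored_part n * 'I_n.+1))%type.

Definition is_two_part (l n : nat) (q : two_part_data n) : bool :=
  let: (x, m, (y, k)) := q in
  [&& precedes x y, 0 < m, 0 < k, m * part_size x + k * part_size y == n,
      x.1 ==> (l %| part_size x) & y.1 ==> (l %| part_size y)].

Definition two_part_mult (n : nat) (q : two_part_data n) :
    {ffun colored_part n -> 'I_n.+1} :=
  let: (x, m, (y, k)) := q in
  [ffun z => if z == x then m else if z == y then k else ord0].

Lemma supp_two_part (l n : nat) (x y : colored_part n) (m k : 'I_n.+1) :
  is_two_part l (x, m, (y, k)) -> supp (two_part_mult (x, m, (y, k))) = [set x; y].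
Proof.
case/and5P=> _ m_gt0 k_gt0 _ _; apply/setP=> z; rewrite !inE ffunE.
by case: eqP => // _; case: eqP.
Qed.

(** The support gives back the unordered pair of parts, and [precedes] its order. *)
Lemma two_part_mult_inj (l n : nat) :
  {in [set q | is_two_part l q] &, injective (@two_part_mult n)}.
Proof.
move=> [[x m] [y k]] [[x' m'] [y' k']]; rewrite !inE => q_ok q'_ok eq_q.
have := supp_two_part q'_ok; rewrite -eq_q (supp_two_part q_ok) => eq_s.
have [xy xy'] : precedes x y /\ precedes x' y' by case/and5P: q_ok; case/and5P: q'_ok.
have [ex ey] : x = x' /\ y = y'.
  have : x \in [set x'; y'] by rewrite -eq_s set21.
  have : y \in [set x'; y'] by rewrite -eq_s set22.
  rewrite !inE; case/orP=> /eqP ey /orP[]/eqP ex //;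
    have := precedes_neq xy; move: xy xy'; rewrite ex ey ?eqxx // => yx xy ne.
  by rewrite (precedes_antisym ne) yx in xy.
move: ex ey eq_q xy => <- <- /ffunP eq_q /precedes_neq xy.
have := eq_q y; have := eq_q x; rewrite !ffunE eqxx eq_sym (negPf xy) eqxx => -> ->.
by [].
Qed.

Lemma card_partitions_supp2 (l n : nat) :
  #|partitions_supp l n 2| = #|[set q : two_part_data n | is_two_part l q]|.
Proof.
rewrite -(card_in_imset (@two_part_mult_inj l n)); apply: eq_card => f.
rewrite inE; apply/andP/imsetP => [[/andP[/eqP sum_f /forallP col_f]] | [[[x m] [y k]]]].
  have eq_f x y : supp f = [set x; y] -> precedes x y ->
      exists2 q, q \in [set q | is_two_part l q] & f = two_part_mult q.
    move=> supp_f /[dup] xy /precedes_neq x_y.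
    have [fx fy] : 0 < f x /\ 0 < f y.
      by move: (set21 x y) (set22 x y); rewrite -supp_f !inE.
    have f0 z : z != x -> z != y -> f z = ord0.
      move=> zx zy; apply/val_inj/eqP; rewrite -leqn0 leqNgt.
      have : z \notin supp f by rewrite supp_f in_set2 negb_or zx.
      by rewrite inE.
    exists (x, f x, (y, f y)).
      rewrite inE /= xy fx fy /=; move: (col_f x) (col_f y); rewrite fx fy !andbT => -> ->.
      rewrite !andbT -[in X in _ == X]sum_f (bigD1 x) // (bigD1 y) 1?eq_sym //= addnA.
      by rewrite [X in _ + X]big1 ?addn0 // => z /andP[zx zy]; rewrite f0.
    apply/ffunP=> z; rewrite ffunE.
    by case: eqVneq => [-> // | zx]; case: eqVneq => [-> // | zy]; rewrite f0.
  case/cards2P=> x [y] [x_y supp_f]; case: (boolP (precedes x y)) => xy.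
    exact: eq_f supp_f xy.
  by apply: (eq_f y x); [rewrite supp_f setUC | rewrite precedes_antisym].
rewrite inE => q_ok ->; rewrite (supp_two_part q_ok) cards2.
have /and5P[/precedes_neq xy _ _ /eqP sum_q /andP[x_ok y_ok]] := q_ok.
rewrite xy; split=> //; apply/andP; split.
  rewrite (bigD1 x) // (bigD1 y) 1?eq_sym //= !ffunE !eqxx (eq_sym y x) (negPf xy).
  rewrite big1 ?addn0 ?sum_q // => z /andP[/negPf zx /negPf zy].
  by rewrite ffunE zx zy.
apply/forallP=> z; apply/implyP=> /andP[z1]; rewrite ffunE.
case: eqP z1 => [-> z1 _ | _]; first exact: (implyP x_ok).
by case: eqP => [-> z1 _ | //]; exact: (implyP y_ok).
Qed.

(** * Conjugation of two-part partitions *)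

Lemma sqr_mod3 (x : nat) : (x * x) %% 3 != 2.
Proof. by rewrite -modnMm; case: (x %% 3) (ltn_pmod x (isT : 0 < 3)) => [|[|[|]]]. Qed.

(** Natural-number coordinates: [m] copies of the unrestricted part [i] and [k] copies of the part
    [j] in colour [c]. The total is [n.+1] so that [inord] has a nonempty target. *)
Definition quad (n : nat) (c : bool) (i m j k : nat) : two_part_data n.+1 :=
  ((false, inord i.-1), inord m, ((c, inord j.-1), inord k)).

Lemma quad_surj (n : nat) (x y : colored_part n.+1) (m k : 'I_n.+2) :
  ~~ x.1 -> (x, m, (y, k)) = quad n y.1 (part_size x) m (part_size y) k.
Proof. by case: x y => [[] i] [c j] // _; rewrite /quad /part_size /= !inord_val. Qed.

Lemma quad_inj (n : nat) (c c' : bool) (i m j k i' m' j' k' : nat) :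
  0 < i <= n.+1 -> 0 < i' <= n.+1 -> m <= n.+1 -> m' <= n.+1 ->
  0 < j <= n.+1 -> 0 < j' <= n.+1 -> k <= n.+1 -> k' <= n.+1 ->
  quad n c i m j k = quad n c' i' m' j' k' -> [/\ c = c', i = i', m = m', j = j' & k = k'].
Proof.
move=> i_n i'_n m_n m'_n j_n j'_n k_n k'_n.
case=> /(congr1 val)/= + /(congr1 val)/= + -> /(congr1 val)/= + /(congr1 val)/=.
by rewrite !inordK; try lia; move=> *; split=> //; lia.
Qed.

Definition quad_eqn (l n : nat) (c : bool) (i m j k : nat) : Prop :=
  [/\ 0 < i, 0 < m, 0 < j & 0 < k] /\
  [/\ m * i + k * j = n, ~~ c -> j < i & c -> l %| j].

(** These bounds make every [inord] in [quad] exact; [m + k] is the large part created by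
    conjugation. *)
Lemma quad_eqn_le (l n : nat) (c : bool) (i m j k : nat) :
  quad_eqn l n c i m j k -> [/\ i <= n, m <= n, j <= n, k <= n & m + k <= n].
Proof. by case=> [[? ? ? ?] [? _ _]]; split; nia. Qed.

Lemma is_two_part_quad (l n : nat) (c : bool) (i m j k : nat) :
  quad_eqn l n.+1 c i m j k -> is_two_part l (quad n c i m j k).
Proof.
move=> /[dup] /quad_eqn_le [i_n m_n j_n k_n _] [[i0 m0 j0 k0] [e c0 c1]].
rewrite /is_two_part /quad /precedes /part_size /= !inordK; try lia.
rewrite !prednK // m0 k0 e eqxx /=.
by case: c c0 c1 => /= c0 c1; rewrite ?c1 //= andbT; move: (c0 isT); lia.
Qed.

(** If the first part were restricted, so would be the second, and 3 would divide the total. *)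
Lemma two_part_quad (l n : nat) (q : two_part_data n.+1) :
  3 %| l -> n.+1 %% 3 = 2 -> is_two_part l q ->
  exists c i m j k, q = quad n c i m j k /\ quad_eqn l n.+1 c i m j k.
Proof.
case: q => [[x m] [y k]] l3 n3 /and5P[xy m0 k0 /eqP e /andP[cx cy]].
have x1 : ~~ x.1.
  apply/negP=> x1; have y1 : y.1 by move: xy; rewrite /precedes x1; case: y.1.
  have := dvdn_trans l3 (implyP cx x1); have := dvdn_trans l3 (implyP cy y1).
  move: e; lia.
exists y.1, (part_size x), m, (part_size y), k; split; first exact: quad_surj.
split=> //; split=> // [y1|]; last exact/implyP.
by move: xy; rewrite /precedes (negPf x1) (negPf y1).
Qed.

(* On two unrestricted parts [i > j] of multiplicities [m], [k], this is conjugation of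
   the partition; on a restricted part [j], it conjugates the unrestricted rectangle. *)
Definition conjugate (n : nat) (q : two_part_data n.+1) : two_part_data n.+1 :=
  let: (x, m, (y, k)) := q in
  if y.1 then quad n true m (part_size x) (part_size y) k
  else quad n false (m + k) (part_size y) m (part_size x - part_size y).

Lemma conjugate_quad (l n : nat) (c : bool) (i m j k : nat) :
  quad_eqn l n.+1 c i m j k ->
  conjugate (quad n c i m j k)
    = if c then quad n c m i j k else quad n c (m + k) j m (i - j).
Proof.
move=> /[dup] /quad_eqn_le [i_n m_n j_n k_n _] [[i0 m0 j0 k0] _].
by case: c; rewrite /conjugate /quad /part_size /= !inordK // ?prednK //; lia.
Qed.

(** For two unrestricted parts, [j * (m + k) + (i - j) * m = m * i + k * j], while [0 < k] and
    [j < i] give the new strict inequalities. *)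
Lemma quad_eqn_conjugate (l n : nat) (c : bool) (i m j k : nat) :
  quad_eqn l n c i m j k ->
  if c then quad_eqn l n c m i j k else quad_eqn l n c (m + k) j m (i - j).
Proof.
case: c => [[[i0 m0 j0 k0] [e _ c1]]|[[i0 m0 j0 k0] [e /(_ isT) ji _]]]; split=> //.
- by split=> //; rewrite -e mulnC.
- by split=> //; lia.
by split=> //; nia.
Qed.

(** The self-conjugate partition [i = m + k], [j = m] attached to the factorisation
    [n.+1 = a * (a + 2 * k)], with [m = a]. *)
Definition diagonal_quad (n a : nat) : two_part_data n.+1 :=
  quad n false (a + (n.+1 %/ a - a)./2) a a (n.+1 %/ a - a)./2.

Lemma odd_card_partitions_supp2 (l n : nat) : 3 %| l -> n %% 3 = 2 ->
  odd #|partitions_supp l n 2|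
  = odd (count (fun a => (a < n %/ a) && (odd a == odd (n %/ a))) (divisors n)).
Proof.
case: n => // n l3 n3; rewrite card_partitions_supp2.
rewrite (@odd_card_involution _ _ (@conjugate n)); first last.
- move=> q; rewrite inE => /(two_part_quad l3 n3)[c [i [m [j [k [-> q_ok]]]]]].
  rewrite (conjugate_quad q_ok); have := quad_eqn_conjugate q_ok.
  case: c q_ok => q_ok /conjugate_quad-> //.
  by case: q_ok => [_ [_ /(_ isT) ji _]]; rewrite subnKC ?addKn // ltnW.
- move=> q; rewrite !inE => /(two_part_quad l3 n3)[c [i [m [j [k [-> q_ok]]]]]].
  rewrite (conjugate_quad q_ok); have := quad_eqn_conjugate q_ok.
  by case: c q_ok => _ /is_two_part_quad.
(* It remains to identify the fixed points of [conjugate] with the image of the counted divisors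
   under [diagonal_quad]. *)
congr odd; rewrite -size_filter -(size_map (diagonal_quad n)) cardE; set s := filter _ _.
have s_n a : a \in s -> exists2 k, 0 < k &
    [/\ 0 < a, n.+1 = a * (a + k.*2), n.+1 %/ a = a + k.*2 & (n.+1 %/ a - a)./2 = k].
  rewrite mem_filter -dvdn_divisors // => /andP[/andP[lt_a odd_a]] /divnK def_n.
  have [b def_b] : exists b, n.+1 %/ a = b by eexists.
  rewrite def_b in lt_a odd_a def_n *; exists (b - a)./2; first by lia.
  have b_a : b = a + (b - a)./2.*2 by move/eqP: odd_a; lia.
  by split=> //; [case: a def_n {lt_a odd_a def_b b_a}; lia | rewrite -b_a mulnC].
have diag_ok a : a \in s -> quad_eqn l n.+1 false (a + (n.+1 %/ a - a)./2) a a (n.+1 %/ a - a)./2.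
  by case/s_n=> k k0 [a0 e _ ->]; do 2!split=> //; nia.
apply/perm_size/uniq_perm; first exact: enum_uniq.
  rewrite map_inj_in_uniq ?filter_uniq ?divisors_uniq // => a b.
  move=> /diag_ok/[dup]/quad_eqn_le[? ? ? ? ?] [[? ? ? ?] _].
  move=> /diag_ok/[dup]/quad_eqn_le[? ? ? ? ?] [[? ? ? ?] _].
  by case/quad_inj; lia.
move=> q; rewrite mem_enum !inE; apply/andP/mapP => [[]|[a a_s ->]]; last first.
  have a_ok := diag_ok a a_s.
  by rewrite is_two_part_quad // (conjugate_quad a_ok) addKn eqxx.
case/(two_part_quad l3 n3)=> [c [i [m [j [k [-> q_ok]]]]]].
rewrite (conjugate_quad q_ok) => /eqP fix_q; have := quad_eqn_conjugate q_ok.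
move: (q_ok) => /[dup] /quad_eqn_le[? ? ? ? ?] [[i0 m0 j0 k0] [e c0 c1]].
case: c fix_q c0 c1 q_ok => fix_q c0 c1 q_ok q'_ok.
  (* A fixed point with a restricted part has [m = i] and 3 dividing [j], so [n.+1] would be a
     square modulo 3. *)
  have i_m : m = i by case: (quad_inj _ _ _ _ _ _ _ _ fix_q); lia.
  have /dvdnP[j' def_j] := dvdn_trans l3 (c1 isT).
  by move: n3 (sqr_mod3 i); rewrite -[X in X %% 3]e i_m def_j mulnA addnC modnMDl => ->.
have [i_mk j_m] : i = m + k /\ j = m by case: (quad_inj _ _ _ _ _ _ _ _ fix_q); lia.
have def_n : n.+1 = (m + k.*2) * m by nia.
have div_n : n.+1 %/ m = m + k.*2 by rewrite def_n mulnK.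
have half_k : (m + k.*2 - m)./2 = k by rewrite addKn doubleK.
exists m; last by rewrite /diagonal_quad div_n half_k i_mk j_m.
rewrite mem_filter -dvdn_divisors // div_n [X in _ %| X]def_n dvdn_mull // oddD odd_double addbF eqxx.
by lia.
Qed.

(** * Overpartition counts in terms of divisor counts *)

Lemma even_size_divisors_mod3 (n : nat) : n %% 3 = 2 -> ~~ odd (size (divisors n)).
Proof.
move=> n3; apply/negP=> /odd_size_divisorsP[|x def_n]; first by case: n n3.
by have := sqr_mod3 x; rewrite mulnn def_n n3.
Qed.

Lemma overp_divisors_mod4 (l n : nat) : 3 %| l -> ~~ (3 %| n) ->
  overp l n = 2 * size (divisors n) %[mod 4].
Proof.
move=> l3 n3; have n_gt0 : 0 < n by case: n n3.
rewrite overp_mod4 // card_partitions_supp1 //.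
by apply: contraNN n3; apply: dvdn_trans.
Qed.

(** Carrying weight 4, the two-part count matters only through its parity, which is that of the
    count in [divisors_parity_mod8]. *)
Lemma overp_divisors_mod8 (l n : nat) : 3 %| l -> n %% 3 = 2 ->
  overp l n = 4 * (~~ odd n * size (divisors n`_2^')) %[mod 8].
Proof.
move=> l3 n3; have n_gt0 : 0 < n by case: n n3.
rewrite -divisors_parity_mod8 ?even_size_divisors_mod3 // overp_mod8 //.
rewrite card_partitions_supp1 //; last first.
  by apply/negP=> /(dvdn_trans l3); rewrite /dvdn n3.
have := odd_card_partitions_supp2 l3 n3; lia.
Qed.

(** * Multiplication by powers of 4, squares modulo 48, and the congruences *)

Lemma odd_part_mul4X (a n : nat) : 0 < n -> (4 ^ a * n)`_2^' = n`_2^'.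
Proof.
move=> n_gt0; rewrite partnM ?expn_gt0 // part_p'nat ?mul1n //.
by rewrite pnatNK pnatX.
Qed.

(** As [4 ^ a] is the square of [2 ^ a], multiplying by it preserves being a square and not being
    one. *)
Lemma odd_size_divisors_mul4X (a n : nat) : 0 < n ->
  odd (size (divisors (4 ^ a * n))) = odd (size (divisors n)).
Proof.
move=> n_gt0; have n4_gt0 : 0 < 4 ^ a * n by rewrite muln_gt0 expn_gt0.
have e4 : 4 ^ a = (2 ^ a) ^ 2 by rewrite -expnM mulnC expnM.
apply/odd_size_divisorsP/odd_size_divisorsP => // [][x def_n].
  have /dvdnP[y def_x] : 2 ^ a %| x by rewrite -(@dvdn_pexp2r _ _ 2) // def_n e4 dvdn_mulr.
  exists y; apply/eqP; rewrite -(eqn_pmul2l (expn_gt0 4 a)) -def_n def_x expnMn e4 mulnC //.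
by exists (2 ^ a * x); rewrite expnMn def_n e4.
Qed.

(** The squares congruent to 1 modulo 6 are 1 or 25 modulo 48, that is [j = 0] or [j = 4]; all
    residues are checked by computation. *)
Lemma sqr_neq_mod48 (n j x : nat) : j \in [:: 1; 2; 3; 5; 6; 7] ->
  x ^ 2 <> 48 * n + 6 * j + 1.
Proof.
move=> j_in /(congr1 (modn^~ 48)); rewrite -addnA mulnC modnMDl -modnXm.
have : x %% 48 \in iota 0 48 by rewrite mem_iota ltn_pmod.
suff /allP/[apply]/allP/(_ j j_in)/eqP :
  all (fun r => all (fun j => r ^ 2 %% 48 != (6 * j + 1) %% 48) [:: 1; 2; 3; 5; 6; 7])
    (iota 0 48) by [].
by vm_compute.
Qed.

Theorem theorem3p2 (l n a : nat) (hl : 1 <= l) (ha : 1 < a) :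
  [/\ forall j : nat, j \in [:: 1; 2; 3; 5; 6; 7] ->
        overp (3 * l) (48 * n + 6 * j + 1) = 0 %[mod 4],
      overp (3 * l) (3 * n + 1) = overp (3 * l) (4 ^ a * (3 * n + 1)) %[mod 4],
      overp (3 * l) (4 ^ a.+1 * (6 * n + 5)) = 0 %[mod 4],
      overp (3 * l) (4 ^ a * (6 * n + 5)) = 0 %[mod 8]
    & overp (3 * l) (3 * n + 2) = overp (3 * l) (4 ^ a * (3 * n + 2)) %[mod 8]].
Proof.
have l3 : 3 %| 3 * l by apply: dvdn_mulr.
have mod3_4X b m : (4 ^ b * m) %% 3 = m %% 3 by rewrite -modnMml -modnXm exp1n mul1n.
have odd_4X b m : 0 < b -> odd (4 ^ b * m) = false by case: b => // b _; rewrite oddM oddX.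
(* The odd part of [4 ^ b * m] is [m], which has an even number of divisors because it is 2 modulo
   3. *)
have mod8_0 b m : 0 < b -> odd m -> m %% 3 = 2 -> overp (3 * l) (4 ^ b * m) = 0 %[mod 8].
  move=> b_gt0 odd_m m3; rewrite overp_divisors_mod8 ?mod3_4X // odd_4X //.
  rewrite odd_part_mul4X ?part_pnat_id; [| |by case: m odd_m {m3}].
    by have := even_size_divisors_mod3 m3; lia.
  by rewrite p'natE // dvdn2 negbK.
have a_gt0 : 0 < a by apply: ltnW.
split.
- move=> j j_in; rewrite overp_divisors_mod4 //; last by lia.
  suff : ~~ odd (size (divisors (48 * n + 6 * j + 1))) by lia.
  by apply/negP=> /odd_size_divisorsP[|x /sqr_neq_mod48]; [rewrite addn1 | apply].
- rewrite !overp_divisors_mod4 //; first last.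
  + by lia.
  + by rewrite /dvdn mod3_4X; lia.
  by have := odd_size_divisors_mul4X a (_ : 0 < 3 * n + 1); rewrite addn1 => /(_ isT); lia.
- rewrite -(@modn_dvdm 8 (overp _ _)) // mod8_0 //; lia.
- by apply: mod8_0; lia.
rewrite !overp_divisors_mod8 ?mod3_4X //; try lia.
have n_gt0 : 0 < 3 * n + 2 by rewrite addn2.
(* For [3 * n + 2] even both sides agree; for it odd the left side is 0 and the right side is 4
   times an even divisor count. *)
rewrite odd_4X // odd_part_mul4X //; case: (boolP (odd (3 * n + 2))) => //= odd_n.
rewrite part_pnat_id; last by rewrite p'natE // dvdn2 negbK.
by have := @even_size_divisors_mod3 (3 * n + 2); lia.
Qed.
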